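(* Let $n\ge3$, let $P$ be a positive-area local optimum, and let $\theta=(\lambda,\ell,r,d,u)$ be a normalized KKT multiplier at $P$ with outward reactions $b_i=(r_i-\ell_i,u_i-d_i)$. Every internally isolated positive two-terminal block $\mathcal H$ (with internal vertex set $I$) has a nonzero full KKT reaction at an internal vertex; that is, there is $i\in I$ with $b_i\ne0$.
   Context: A configuration is $P=(p_1,\dots,p_n)$ with $p_i=(x_i,y_i)\in[0,1]^2$. For a triple $t=(i,j,k)$, $i<j<k$, put $D_t(P)=\det(p_j-p_i,p_k-p_i)$, $A_t(P)=\tfrac12|D_t(P)|$, and $\delta(P)=\min_tA_t(P)$. A positive-area local optimum is a local maximizer $P$ of $\delta$ on $([0,1]^2)^n$ with $\Delta:=\delta(P)>0$. Near $P$, $A_t=\tfrac12\operatorname{sgn}(D_t(P))D_t$, which is used for derivatives. A normalized KKT multiplier at $P$ is a tuple of nonnegative reals $\lambda_t$ (all triples $t$), $\ell_i,r_i,d_i,u_i$ ($i\in[n]$) with: $\lambda_t=0$ unless $A_t(P)=\Delta$; $\ell_i=0$ unless $x_i=0$, $r_i=0$ unless $x_i=1$, $d_i=0$ unless $y_i=0$, $u_i=0$ unless $y_i=1$; $\sum_t\lambda_t=1$; and $\sum_t\lambda_t\nabla_{p_i}A_t(P)+(\ell_i-r_i,d_i-u_i)=0$ for all $i$. For the fixed multiplier, a triangle $t$ is positive if $\lambda_t>0$. A positive two-terminal block is a nonempty family $\mathcal H$ of positive triangles together with a partition of its vertex set $V(\mathcal H)=I\sqcup\{a,b\}$, $a\ne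 b$; $I$ is the internal vertex set and $a,b$ are the terminals. It is internally isolated if no positive triangle outside $\mathcal H$ contains a vertex of $I$. *)

(* Defs.v *)
From mathcomp Require Import all_boot all_order all_algebra.
From mathcomp Require Import all_classical all_reals all_analysis.

Set Implicit Arguments.
Unset Strict Implicit.
Unset Printing Implicit Defensive.

Import Order.TTheory GRing.Theory Num.Theory.
Import numFieldNormedType.Exports.

Local Open Scope ring_scope.

Definition triple (n : nat) : Type :=
  {t : 'I_n * 'I_n * 'I_n | (t.1.1 < t.1.2 < t.2)%N}.

Definition tri_i (n : nat) (t : triple n) : 'I_n := (val t).1.1.
Definition tri_j (n : nat) (t : triple n) : 'I_n := (val t).1.2.
Definition tri_k (n : nat) (t : triple n) : 'I_n := (val t).2.

Definition vertices (n : nat) (t : triple n) : {set 'I_n} :=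
  [set tri_i t; tri_j t; tri_k t]%SET.

Definition family_vertices (n : nat) (H : {set triple n}) : {set 'I_n} :=
  (\bigcup_(t in H) vertices t)%SET.

Section Configurations.
Variables (R : realType) (n : nat).

(* A configuration is a matrix P whose row i is the point p_i = (x_i, y_i). *)
Implicit Types (P Q : 'M[R]_(n, 2)) (t : triple n).

Definition xcoord P (i : 'I_n) : R := P i 0.
Definition ycoord P (i : 'I_n) : R := P i 1.

Definition unit_square_configs : set 'M[R]_(n, 2) :=
  [set P | forall i, 0 <= xcoord P i <= 1 /\ 0 <= ycoord P i <= 1]%classic.

Definition signed_area2 t P : R :=
  \det (col_mx (row (tri_j t) P - row (tri_i t) P)
               (row (tri_k t) P - row (tri_i t) P)).

Definition area t P : R := 2^-1 * `|signed_area2 t P|.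

(* For 3 <= n the set is finite and nonempty, so that inf is a minimum. *)
Definition min_area P : R := inf (range (fun t => area t P)).

Definition local_maximizer P : Prop :=
  unit_square_configs P /\
  \forall Q \near within unit_square_configs (nbhs P),
    min_area Q <= min_area P.

Definition positive_area_local_optimum P : Prop :=
  local_maximizer P /\ 0 < min_area P.

(* Gradient of A_t with respect to p_i only, as a row vector. *)
Definition grad_area t P (i : 'I_n) : 'rV[R]_2 :=
  \row_(c < 2) ('D_(delta_mx i c : 'M[R]_(n, 2)) (area t) P : R).

Definition pair_row (x y : R) : 'rV[R]_2 :=
  \row_(c < 2) (if c == 0 then x else y).

Record multiplier : Type := Multiplier {
  lam : triple n -> R;
  left_mult : 'I_n -> R;
  right_mult : 'I_n -> R;
  down_mult : 'I_n -> R;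
  up_mult : 'I_n -> R }.

Implicit Type th : multiplier.

Record normalized_kkt P th : Prop := NormalizedKKT {
  lam_ge0 : forall t, 0 <= lam th t;
  left_ge0 : forall i, 0 <= left_mult th i;
  right_ge0 : forall i, 0 <= right_mult th i;
  down_ge0 : forall i, 0 <= down_mult th i;
  up_ge0 : forall i, 0 <= up_mult th i;
  lam_slack : forall t, area t P <> min_area P -> lam th t = 0;
  left_slack : forall i, xcoord P i <> 0 -> left_mult th i = 0;
  right_slack : forall i, xcoord P i <> 1 -> right_mult th i = 0;
  down_slack : forall i, ycoord P i <> 0 -> down_mult th i = 0;
  up_slack : forall i, ycoord P i <> 1 -> up_mult th i = 0;
  lam_sum1 : \sum_(t : triple n) lam th t = 1;
  stationarity : forall i,
    \sum_(t : triple n) lam th t *: grad_area t P i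
    + pair_row (left_mult th i - right_mult th i)
               (down_mult th i - up_mult th i) = 0 }.

Definition reaction th (i : 'I_n) : 'rV[R]_2 :=
  pair_row (right_mult th i - left_mult th i) (up_mult th i - down_mult th i).

Definition positive_triangle th t : Prop := 0 < lam th t.

Record positive_two_terminal_block th (H : {set triple n})
    (I : {set 'I_n}) (a b : 'I_n) : Prop := PositiveTwoTerminalBlock {
  block_neq0 : H != finset.set0;
  block_positive : forall t, t \in H -> positive_triangle th t;
  block_terminals : a != b;
  block_disjoint : [disjoint I & ([set a; b]%SET : {set 'I_n})];
  block_cover : family_vertices H = (I :|: [set a; b])%SET :> {set 'I_n} }.

Definition internally_isolated th (H : {set triple n}) (I : {set 'I_n}) : Prop :=
  forall t, positive_triangle th t -> t \notin H -> [disjoint vertices t & I].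

End Configurations.

(* Main.v *)
(** If all internal reactions vanish, then the weighted area
    F = sum of lambda_t A_t over the block has zero gradient at every internal
    vertex, by isolation.  Choose a 2x2 matrix E of positive trace killing
    p_b - p_a, and move each p_i with velocity (p_i - p_a) E.  The terminals stay
    put, so F is stationary along this motion; but areas scale by the determinant,
    so its derivative is tr(E) F > 0. *)
Require Import Defs.
From mathcomp Require Import all_boot all_order all_algebra.
From mathcomp Require Import all_classical all_reals all_analysis.
From mathcomp Require Import ring lra.

Set Implicit Arguments.
Unset Strict Implicit.
Unset Printing Implicit Defensive.

Import Order.TTheory GRing.Theory Num.Theory.
Import numFieldNormedType.Exports.

Local Open Scope ring_scope.

(** For small [h] the affine function [u + h * w] keeps the sign of [u], so the absolute value opens
    and the difference quotient is eventually constant; the limit is that constant. *)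
Lemma derive_norm_affine (R : realType) (V : normedModType R) (f : V -> R)
    (p v : V) (k u w : R) :
  u != 0 -> (forall h, f (h *: v + p) = k * `|u + h * w|) ->
  'D_v f p = k * (Num.sg u * w).
Proof.
move=> u0 fE; rewrite /derive; apply: lim_near_cst => //.
have nu : 0 < `|u| by rewrite normr_gt0.
have w1 : 0 < `|w| + 1 by rewrite ltr_wpDl.
(* For [h] below this radius [h * w] cannot cancel [u]; the [+ 1] covers [w = 0]. *)
have e0 : 0 < `|u| / (`|w| + 1) by rewrite divr_gt0.
have fp : f p = k * `|u| by have := fE 0; rewrite scale0r add0r mul0r addr0.
near=> h.
have h0 : h != 0 by near: h; exact: nbhs_dnbhs_neq.
have hw : `|h * w| < `|u|.
  have : `|h| < `|u| / (`|w| + 1) by near: h; exact: dnbhs0_lt.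
  rewrite ltr_pdivlMr // normrM; apply: le_lt_trans.
  by rewrite ler_wpM2l // lerDl.
have sE : `|u + h * w| = Num.sg u * (u + h * w).
  case: (ltrgt0P u) u0 hw => // u_sgn _; rewrite ltr_norml => /andP[hl hr].
  - by rewrite gtr0_sg // mul1r ger0_norm //; lra.
  - by rewrite ltr0_sg // mulN1r ler0_norm //; lra.
rewrite /= fE fp sE (normrEsg u) /GRing.scale /=.
by field.
Unshelve. all: by end_near. Qed.

Lemma det_mx22 (R : comNzRingType) (M : 'M[R]_2) :
  \det M = M 0 0 * M 1 1 - M 0 1 * M 1 0.
Proof.
rewrite (expand_det_row _ 0) !big_ord_recl big_ord0 addr0 /cofactor !det_mx11.
rewrite !mxE /= expr0 expr1 mul1r mulN1r mulrN.
by congr (M _ _ * M _ _ - M _ _ * M _ _); apply/val_inj.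
Qed.

Section AreaDerivative.
Variables (R : realType) (n : nat).
Implicit Types (P V W : 'M[R]_(n, 2)) (t : triple n).

Lemma signed_area2E t P :
  signed_area2 t P =
  (P (tri_j t) 0 - P (tri_i t) 0) * (P (tri_k t) 1 - P (tri_i t) 1)
  - (P (tri_j t) 1 - P (tri_i t) 1) * (P (tri_k t) 0 - P (tri_i t) 0).
Proof.
have split2 (u v : 'rV[R]_2) (c : 'I_2) :
    ((col_mx u v : 'M[R]_2) 0 c = u 0 c) * ((col_mx u v : 'M[R]_2) 1 c = v 0 c).
  split; first by rewrite -(col_mxEu u v); congr (col_mx u v _ _); apply/val_inj.
  by rewrite -(col_mxEd u v); congr (col_mx u v _ _); apply/val_inj.
by rewrite /signed_area2 det_mx22 !split2 !mxE.
Qed.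

(** The differential at [P] in direction [V] of the quadratic form [signed_area2 t], that is, its
    polarization. *)
Definition signed_area2_diff t P V : R :=
  (V (tri_j t) 0 - V (tri_i t) 0) * (P (tri_k t) 1 - P (tri_i t) 1)
  + (P (tri_j t) 0 - P (tri_i t) 0) * (V (tri_k t) 1 - V (tri_i t) 1)
  - (V (tri_j t) 1 - V (tri_i t) 1) * (P (tri_k t) 0 - P (tri_i t) 0)
  - (P (tri_j t) 1 - P (tri_i t) 1) * (V (tri_k t) 0 - V (tri_i t) 0).

Lemma signed_area2_diff0 t P : signed_area2_diff t P 0 = 0.
Proof. by rewrite /signed_area2_diff !mxE; ring. Qed.

Lemma signed_area2_diffD t P :
  {morph signed_area2_diff t P : V W / V + W}.
Proof. by move=> V W; rewrite /signed_area2_diff !mxE; ring. Qed.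

Lemma signed_area2_diffZ t P (k : R) V :
  signed_area2_diff t P (k *: V) = k * signed_area2_diff t P V.
Proof. by rewrite /signed_area2_diff !mxE; ring. Qed.

Lemma signed_area2_line t P V (h : R) :
  signed_area2 t (h *: V + P) =
  signed_area2 t P + h * signed_area2_diff t P V + h ^+ 2 * signed_area2 t V.
Proof. by rewrite !signed_area2E /signed_area2_diff !mxE; ring. Qed.

(** Each product in the determinant pairs an x-difference with a y-difference, and a coordinate
    direction makes one of them vanish. Hence the doubled signed area is affine along such a
    direction. *)
Lemma signed_area2_delta t (i : 'I_n) (c : 'I_2) :
  signed_area2 t (delta_mx i c : 'M[R]_(n, 2)) = 0.
Proof.
rewrite signed_area2E !mxE.
by case: c => [[|[|//]] ?]; rewrite -!val_eqE /= !andbF !subr0 ?mulr0 ?mul0r subr0.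
Qed.

Lemma area_gt0 t P : (0 < area t P) = (signed_area2 t P != 0).
Proof. by rewrite /area pmulr_rgt0 ?invr_gt0 // normr_gt0. Qed.

Lemma grad_areaE t P (i : 'I_n) (c : 'I_2) : 0 < area t P ->
  grad_area t P i 0 c =
  2^-1 * (Num.sg (signed_area2 t P) * signed_area2_diff t P (delta_mx i c)).
Proof.
rewrite area_gt0 mxE => D0; apply: derive_norm_affine => // h.
by rewrite /area signed_area2_line signed_area2_delta mulr0 addr0.
Qed.

Lemma grad_area_notin t P (i : 'I_n) : 0 < area t P -> i \notin vertices t ->
  grad_area t P i = 0.
Proof.
move=> t0; rewrite !inE !negb_or => /andP[/andP[/negPf ii /negPf ij] /negPf ik].
apply/rowP => c; rewrite grad_areaE // /signed_area2_diff !mxE.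
by rewrite !(eq_sym _ i) ii ij ik /=; ring.
Qed.

(** The differential is linear in [V], so expanding [V] in the matrices [delta_mx i c] assembles the
    partial derivatives into the derivative along any motion. *)
Lemma sum_grad_area t P V : 0 < area t P ->
  \sum_i \sum_c V i c * grad_area t P i 0 c =
  2^-1 * (Num.sg (signed_area2 t P) * signed_area2_diff t P V).
Proof.
move=> t0; rewrite [in RHS](matrix_sum_delta V).
rewrite (big_morph _ (signed_area2_diffD t P) (signed_area2_diff0 t P)).
rewrite !mulr_sumr; apply: eq_bigr => i _.
rewrite (big_morph _ (signed_area2_diffD t P) (signed_area2_diff0 t P)).
rewrite !mulr_sumr; apply: eq_bigr => c _.
by rewrite signed_area2_diffZ grad_areaE //; ring.
Qed.

(* Area is multiplied by [\det] under a linear map, and the derivative of [\det]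
   at the identity is the trace. *)
Lemma sum_grad_area_affine t P (q : 'rV[R]_2) (E : 'M[R]_2) : 0 < area t P ->
  \sum_i \sum_c ((row i P - q) *m E) 0 c * grad_area t P i 0 c =
  \tr E * area t P.
Proof.
move=> t0; pose V : 'M[R]_(n, 2) := \matrix_(i, c) ((row i P - q) *m E) 0 c.
transitivity (\sum_i \sum_c V i c * grad_area t P i 0 c).
  by apply: eq_bigr => i _; apply: eq_bigr => c _; rewrite [V i c]mxE.
rewrite sum_grad_area // /area normrEsg.
suff -> : signed_area2_diff t P V = \tr E * signed_area2 t P by ring.
rewrite signed_area2E /signed_area2_diff /mxtrace !big_ord_recl big_ord0.
rewrite !mxE !big_ord_recl !big_ord0 !mxE.
have -> : lift ord0 ord0 = 1 :> 'I_2 by apply/val_inj.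
by ring.
Qed.

End AreaDerivative.

Lemma annihilator_pos_trace (R : realType) (w : 'rV[R]_2) :
  exists2 E : 'M[R]_2, w *m E = 0 & 0 < \tr E.
Proof.
have [->|w0] := eqVneq w 0.
  by exists 1%:M; rewrite ?mul0mx // mxtrace1 ltr0n.
(* [v] is [w] rotated by a right angle: the rank-one matrix [v^T *m v] kills [w], and its trace is
   the squared length of [w]. *)
pose v : 'rV[R]_2 := pair_row (w 0 1) (- w 0 0).
have l1 : lift ord0 ord0 = 1 :> 'I_2 by apply/val_inj.
exists (v^T *m v).
  apply/rowP => c; rewrite mulmxA !mxE big_ord1 !mxE big_ord_recl big_ord1 l1.
  by rewrite !mxE /=; ring.
rewrite /mxtrace big_ord_recl big_ord1 l1 !mxE !big_ord1 !mxE /=.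
rewrite mulrNN -!expr2.
rewrite lt_def addr_ge0 ?sqr_ge0 // andbT paddr_eq0 ?sqr_ge0 // !sqrf_eq0.
apply: contra w0 => /andP[/eqP w1 /eqP w0]; apply/eqP/rowP => c; rewrite mxE.
by case: c => [[|[|//]] ?]; [rewrite -[RHS]w0|rewrite -[RHS]w1];
  congr (w _ _); apply/val_inj.
Qed.

Lemma reaction0_sum_grad (R : realType) (n : nat) (P : 'M[R]_(n, 2))
    (th : multiplier R n) (i : 'I_n) :
  normalized_kkt P th -> reaction th i = 0 ->
  \sum_(t : triple n) lam th t *: grad_area t P i = 0.
Proof.
move=> kkt ri; rewrite -[RHS](stationarity kkt i).
suff -> : pair_row (left_mult th i - right_mult th i)
            (down_mult th i - up_mult th i) = - reaction th i.
  by rewrite ri oppr0 addr0.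
by apply/rowP => c; rewrite !mxE; case: ifP; rewrite opprB.
Qed.

Theorem theorem7p5 (R : realType) (n : nat) (P : 'M[R]_(n, 2))
    (th : multiplier R n) (H : {set triple n}) (I : {set 'I_n}) (a b : 'I_n) :
  (3 <= n)%N ->
  positive_area_local_optimum P ->
  normalized_kkt P th ->
  positive_two_terminal_block th H I a b ->
  internally_isolated th H I ->
  exists2 i : 'I_n, i \in I & reaction th i != 0.

Proof.
move=> _ [_ Dpos] kkt blk iso.
(* By complementary slackness a positive triangle has area [min_area P], which is positive, so the
   gradient formulas apply to it. *)
have areaP t : positive_triangle th t -> 0 < area t P.
  move=> lt; have [-> //|/eqP/(lam_slack kkt) l0] := eqVneq (area t P) (min_area P).
  by move: lt; rewrite /positive_triangle l0 ltxx.
have areaH t : t \in H -> 0 < area t P by move=> /(block_positive blk)/areaP.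
apply: contrapT => noreac.
have reac0 i : i \in I -> reaction th i = 0.
  by move=> iI; apply/eqP/negPn/negP => r0; apply: noreac; exists i.
(* Stationarity sums over all triples. Outside [H] a term vanishes either because its multiplier is
   zero or because isolation keeps [i] out of the triangle. *)
have internal0 i : i \in I -> \sum_(t in H) lam th t *: grad_area t P i = 0.
  move=> iI; rewrite -[RHS](reaction0_sum_grad kkt (reac0 i iI)).
  rewrite [RHS](bigID (mem H)) /= [X in _ = _ + X]big1 ?addr0 // => t tH.
  have := lam_ge0 kkt t; rewrite le_eqVlt => /predU1P[<-|lt].
    by rewrite scale0r.
  rewrite grad_area_notin ?scaler0 ?areaP //.
  by have /pred0P/(_ i) := iso t lt tH; rewrite /= iI andbT => /negbT.
have [E Ew trE] := annihilator_pos_trace (row b P - row a P).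
pose V i := (row i P - row a P) *m E.
(* This sum is the derivative of the weighted area along [V]; its terms are positive and [H] is
   nonempty, so it cannot be zero. *)
suff : \sum_(t in H) lam th t * (\tr E * area t P) = 0.
  have pos t : t \in H -> 0 < lam th t * (\tr E * area t P).
    move=> tH; apply: mulr_gt0; first exact: (block_positive blk).
    by rewrite mulr_gt0 ?areaH.
  have /set0Pn[t0 t0H] := block_neq0 blk.
  apply/eqP; rewrite gt_eqF // (bigD1 t0) //= ltr_wpDr ?pos // sumr_ge0 // => t.
  by move=> /andP[tH _]; exact/ltW/pos.
(* The same derivative is regrouped by vertices instead of triangles. *)
transitivity (\sum_i \sum_c V i 0 c *
    (\sum_(t in H) lam th t *: grad_area t P i) 0 c).
  under eq_bigr => t tH.
    rewrite -(sum_grad_area_affine (row a P)) ?areaH //.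
    rewrite mulr_sumr; under eq_bigr do rewrite mulr_sumr.
    over.
  rewrite exchange_big /=; apply: eq_bigr => i _.
  rewrite exchange_big /=; apply: eq_bigr => c _.
  rewrite summxE mulr_sumr; apply: eq_bigr => t _.
  by rewrite [X in _ = _ * X]mxE mulrCA.
(* Every vertex contributes zero: internal ones have zero gradient, [a] has zero velocity, [E] kills
   the velocity of [b], and all others lie in no triangle of [H]. *)
apply: big1 => i _; apply: big1 => c _.
have [iI|iI] := boolP (i \in I); first by rewrite internal0 // [X in _ * X]mxE mulr0.
have [->|ia] := eqVneq i a; first by rewrite /V subrr mul0mx mxE mul0r.
have [->|ib] := eqVneq i b; first by rewrite /V Ew mxE mul0r.
rewrite big1 => [|t tH]; first by rewrite [X in _ * X]mxE mulr0.
rewrite grad_area_notin ?scaler0 ?areaH //.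
apply/negP => it; suff: i \in family_vertices H.
  by rewrite (block_cover blk) !inE (negPf iI) (negPf ia) (negPf ib).
by apply/bigcupP; exists t.
Qed.
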